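(* Let $k\ge1$ and $\delta>0$, and let $\mu$ be a Borel probability measure on $\{0,1\}^{[k]^\ast}$ such that $\mu\{\mathbf x:\ x_w=1\}\ge\delta$ for every $w\in[k]^\ast$. Then there is a combinatorial line $\phi:[k]\hookrightarrow[k]^\ast$ such that \[\mu\{\mathbf x\in\{0,1\}^{[k]^\ast}:\ x_{\phi(i)}=1\ \forall i\in[k]\}>0.\]
   Context: $[k]^\ast=\bigcup_{N\ge1}[k]^N$ is the set of finite nonempty words over $[k]=\{1,\dots,k\}$. A combinatorial line in $[k]^\ast$ is an injection $\phi:[k]\hookrightarrow[k]^\ast$ specified by an integer $N_1\ge1$, a nonempty $I_1\subseteq[N_1]$ and a word $w\in[k]^{N_1}$, where $\phi(v)\in[k]^{N_1}$ is given by $\phi(v)_m=w_m$ for $m\in[N_1]\setminus I_1$ and $\phi(v)_m=v$ for $m\in I_1$. *)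

(* Defs.v *)
From Stdlib Require Import Reals List Arith.
Import ListNotations.
Open Scope R_scope.

Definition is_word (k : nat) (w : list nat) : Prop :=
  w <> [] /\ Forall (fun a => (1 <= a <= k)%nat) w.

Definition Word (k : nat) : Type := { w : list nat | is_word k w }.

Definition Config (k : nat) : Type := Word k -> bool.

Definition cset (k : nat) : Type := Config k -> Prop.

(* Product topology (discrete {0,1} in each coordinate): U is open iff every
   point of U has a basic cylinder neighbourhood (fixing finitely many
   coordinates) contained in U. *)
Definition is_open (k : nat) (U : cset k) : Prop :=
  forall x, U x -> exists F : list (Word k),
    forall y, (forall w, In w F -> y w = x w) -> U y.

Definition is_sigma_algebra (k : nat) (S : cset k -> Prop) : Prop :=
  S (fun _ => True) /\
  (forall A, S A -> S (fun x => ~ A x)) /\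
  (forall A : nat -> cset k, (forall n, S (A n)) -> S (fun x => exists n, A n x)).

Definition borel (k : nat) (A : cset k) : Prop :=
  forall S : cset k -> Prop, is_sigma_algebra k S ->
    (forall U, is_open k U -> S U) -> S A.

(* A Borel probability measure (mu is only constrained on Borel sets). *)
Definition borel_prob_measure (k : nat) (mu : cset k -> R) : Prop :=
  (forall A, borel k A -> 0 <= mu A) /\
  mu (fun _ => True) = 1 /\
  (forall A : nat -> cset k,
     (forall n, borel k (A n)) ->
     (forall n m x, n <> m -> A n x -> A m x -> False) ->
     infinite_sum (fun n => mu (A n)) (mu (fun x => exists n, A n x))).

(* Combinatorial line: N1 >= 1, nonempty I1 within the positions 0..N1-1
   (0-based positions), base word w in [k]^N1; phi(v)_m = w_m if m notin I1,
   and v if m in I1. *)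
Definition line_word (N1 : nat) (I1 : nat -> bool) (w : list nat) (v : nat)
  : list nat :=
  map (fun m => if I1 m then v else nth m w 0%nat) (seq 0 N1).

Definition is_line_data (k N1 : nat) (I1 : nat -> bool) (w : list nat) : Prop :=
  (1 <= N1)%nat /\
  (exists m, (m < N1)%nat /\ I1 m = true) /\
  length w = N1 /\ Forall (fun a => (1 <= a <= k)%nat) w.

(* Main.v *)
Require Import Defs.
From Stdlib Require Import Reals List Arith Lra Lia.
From Stdlib Require Import Classical FunctionalExtensionality PropExtensionality.
From mathcomp Require all_boot all_order all_algebra lra ring Rstruct.

(** The statement follows from the density Hales-Jewett theorem: if every line were null, then
    for almost every [x] the set of words [w] of a fixed large length with [x w = true] would be
    line-free, hence of density below [delta / 2], whereas its mean density is at least [delta].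

    The density theorem is proved by induction on the alphabet [K], passing to [option K] along
    the lines of Polymath and of Dodos, Kanellopoulos and Tyros, with the uniform measure
    throughout.  Take a line-free set [A] whose density is almost critical, so that no subspace
    of large dimension sees a larger density; then all sections of [A] have almost the critical
    density.  The theorem for [K], combined with a colouring argument based on the Hales-Jewett
    theorem, gives a subspace [V] (in fact a family of subspaces) on which the set [D] of points
    all of whose images under [None |-> a], [a] in [K], are in [A] is dense.  Since [A] has no
    line it avoids [D], so that [A] is too dense on the complement of [D].  But [D] is an
    intersection of sets that are insensitive to exchanging [None] and some [a], and insensitive
    sets are almost partitioned into large subspaces, again by the theorem for [K]. *)

Module DensityHalesJewett.

Import all_boot all_order all_algebra lra ring Rstruct.
Import Order.TTheory GRing.Theory Num.Theory.

Set Implicit Arguments.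
Unset Strict Implicit.
Unset Printing Implicit Defensive.

Local Open Scope nat_scope.

(** Up to bijection a finite type arises from [void] by adding points one at a time; this serves
    both for alphabets and for dimensions. *)
Lemma finType_option_ind (P : finType -> Prop) :
  P void -> (forall J : finType, P J -> P (option J)) ->
  (forall (J J' : finType) (f : J -> J'), bijective f -> P J -> P J') ->
  forall J, P J.
Proof.
move=> P0 PS Pbij J.
suff /(_ _ _ erefl): forall n (J : finType), #|J| = n -> P J by [].
elim=> [|n IHn] {}J cardJ.
  apply: (Pbij void _ (fun v : void => match v with end)) => //.
  have noJ : J -> False by move=> x; have := card0_eq cardJ x.
  by exists (fun x : J => False_rect _ (noJ x)); [case | move=> x; case: (noJ x)].
have cardO : #|{: option 'I_n}| = #|J| by rewrite card_option card_ord cardJ.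
apply: (Pbij (option 'I_n) _ (fun x => enum_val (cast_ord cardO (enum_rank x)))).
  exists (fun y => enum_val (cast_ord (esym cardO) (enum_rank y))) => x.
    by rewrite enum_valK cast_ordK enum_rankK.
  by rewrite enum_valK cast_ordKV enum_rankK.
by apply/PS/IHn; rewrite card_ord.
Qed.

(** * Words, subspaces and lines *)

Notation word I K := {ffun I -> K}.
(** A coordinate carries a fixed letter [inl a] or a variable [inr j]; the genuine
    [#|J|]-dimensional subspaces are the [full] ones. *)
Notation subspace I J K := {ffun I -> K + J}.

Section Words.
Variables (I J K : finType).

Definition point (s : subspace I J K) (z : word J K) : word I K :=
  [ffun i => match s i with inl a => a | inr j => z j end].

Definition full (s : subspace I J K) := forall j, exists i, s i = inr j.

Definition wcat (x : word I K) (y : word J K) : word (I + J)%type K :=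
  [ffun i => match i with inl i => x i | inr j => y j end].

Lemma point_inj s : full s -> injective (point s).
Proof.
move=> fs z z' /ffunP eqs; apply/ffunP=> j; have [i si] := fs j.
by have := eqs i; rewrite !ffunE si.
Qed.

End Words.

Notation line I K := (subspace I unit K).
Notation lpoint l a := (point l [ffun=> a]).

Section Composition.
Variables (I J L K : finType).

Definition scomp (s : subspace I J K) (t : subspace J L K) : subspace I L K :=
  [ffun i => match s i with inl a => inl a | inr j => t j end].

Lemma point_comp s t z : point (scomp s t) z = point s (point t z).
Proof. by apply/ffunP=> i; rewrite !ffunE; case: (s i) => // j; rewrite ffunE. Qed.

Lemma full_comp s t : full s -> full t -> full (scomp s t).
Proof.
move=> fs ft l; have [j tj] := ft l; have [i si] := fs j.
by exists i; rewrite ffunE si.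
Qed.

End Composition.

(** * The Hales-Jewett theorem *)

Definition coloring_HJ (K : finType) := forall C : finType, exists I : finType,
  forall chi : word I K -> C, exists2 l : line I K, full l &
    forall a b, chi (lpoint l a) = chi (lpoint l b).

(* A word over [option K] in which [None] occurs also encodes a line over [K]; then
   [fold_None a] is its point at [a]. *)
Definition fold_None (K : finType) (a0 : K) (I : finType) (z : word I (option K)) :
  word I (option K) := [ffun i => Some (odflt a0 (z i))].

(* Shelah's pigeonhole: among the |C|+1 words [None^j a0^(|C|-j)] two have the same colour. *)
Lemma shelah_line (K C : finType) (a0 : K) : exists I : finType,
  forall chi : word I (option K) -> C, exists2 l : line I (option K), full l &
    chi (lpoint l (Some a0)) = chi (lpoint l None).
Proof.
exists 'I_#|C| => chi.
pose w (j : nat) : word 'I_#|C| (option K) :=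
  [ffun i : 'I_#|C| => if i < j then None else Some a0].
have /injectivePn [j1 [j2 neq eqc]] :
    ~~ injectiveb (fun j : 'I_(#|C|.+1) => chi (w j)).
  by apply/injectiveP => /leq_card; rewrite card_ord ltnn.
wlog lt12 : j1 j2 {neq} eqc / j1 < j2.
  move=> H; case: (ltngtP j1 j2) => [lt|lt|/val_inj eq].
  - exact: H lt.
  - exact: H (esym eqc) lt.
  - by rewrite eq eqxx in neq.
pose l : line 'I_#|C| (option K) := [ffun i : 'I_#|C| =>
  if i < j1 then inl None else if i < j2 then inr tt else inl (Some a0)].
exists l.
  case; have lt1 : j1 < #|C| by rewrite (leq_trans lt12) // -ltnS.
  by exists (Ordinal lt1); rewrite ffunE /= ltnn lt12.
suff [-> ->] : lpoint l (Some a0) = w j1 /\ lpoint l None = w j2 by [].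
split; apply/ffunP=> i; rewrite !ffunE.
  by case: ltnP => // le1; case: ifP => //; rewrite ffunE.
case: ltnP => [lt1|le1]; first by rewrite (ltn_trans lt1 lt12).
by case: ifP => //; rewrite ffunE.
Qed.

(** Each variable comes from a Shelah line. That line must work for all words on the other
    coordinates, and the other variables for all letters of the new one, so colourings are used as
    colours. *)
Lemma insensitive_subspace (K : finType) (a0 : K) (J : finType) :
  forall C : finType, exists I : finType, forall chi : word I (option K) -> C,
    exists2 s : subspace I J (option K), full s &
      forall z, chi (point s z) = chi (point s (fold_None a0 z)).
Proof.
elim/finType_option_ind: J => [C|J IHJ C|J J' f [g fK gK] IHJ C].
- exists void => chi; exists [ffun i : void => match i with end]; first by case.
  by move=> z; congr chi; apply/ffunP; case.
- have [I2 HI2] := IHJ {ffun option K -> C}.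
  have [I1 HI1] := shelah_line {ffun word I2 (option K) -> C} a0.
  exists (I1 + I2)%type => chi.
  have [l fl Hl] := HI1 (fun x1 => [ffun x2 => chi (wcat x1 x2)]).
  have [s fs Hs] := HI2 (fun x2 => [ffun b => chi (wcat (lpoint l b) x2)]).
  pose t : subspace (I1 + I2)%type (option J) (option K) := [ffun i => match i with
    | inl i => match l i with inl a => inl a | inr _ => inr None end
    | inr i => match s i with inl a => inl a | inr j => inr (Some j) end end].
  have tE z : point t z = wcat (lpoint l (z None)) (point s [ffun j => z (Some j)]).
    by apply/ffunP=> -[i|i]; rewrite !ffunE; [case: (l i)|case: (s i)] => // j;
      rewrite ffunE.
  exists t.
    case=> [j|]; [have [i si] := fs j | have [i li] := fl tt].
      by exists (inr i); rewrite ffunE si.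
    by exists (inl i); rewrite ffunE li.
  move=> z; rewrite !tE.
  have /ffunP/(_ (z None)) := Hs [ffun j => z (Some j)]; rewrite !ffunE => ->.
  have -> : fold_None a0 [ffun j => z (Some j)] = [ffun j => fold_None a0 z (Some j)].
    by apply/ffunP=> j; rewrite !ffunE.
  case: (z None) => //=.
  by have /ffunP/(_ (point s [ffun j => fold_None a0 z (Some j)])) := Hl; rewrite !ffunE.
- have [I HI] := IHJ C; exists I => chi; have [s fs Hs] := HI chi.
  pose t : subspace I J' (option K) :=
    [ffun i => match s i with inl a => inl a | inr j => inr (f j) end].
  have tE z : point t z = point s [ffun j => z (f j)].
    by apply/ffunP=> i; rewrite !ffunE; case: (s i) => // j; rewrite ffunE.
  exists t; first by move=> j; have [i si] := fs (g j); exists i; rewrite ffunE si gK.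
  move=> z; rewrite !tE Hs; congr (chi (point s _)).
  by apply/ffunP=> j; rewrite !ffunE.
Qed.

(** On an insensitive subspace the colour depends only on a word over [K]; a monochromatic line over
    [K] extends, its point at [None] being coloured like the one at [a0]. *)
Theorem hales_jewett (K : finType) : coloring_HJ K.
Proof.
elim/finType_option_ind: K => [C|K IHK C|K K' f [g fK gK] IHK C].
- by exists unit => chi; exists [ffun=> inr tt]; [case; exists tt; rewrite ffunE | case].
- case: (pickP (mem K)) => [a0 _|K0]; last first.
    exists unit => chi; exists [ffun=> inr tt]; first by case; exists tt; rewrite ffunE.
    by case=> [a|] [b|]; do ?[by have := K0 a]; do ?[by have := K0 b].
  have [J HJ] := IHK C; have [I HI] := insensitive_subspace a0 J C.
  exists I => chi; have [s fs Hs] := HI chi.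
  have [l fl Hl] := HJ (fun w => chi (point s [ffun j => Some (w j)])).
  pose l' : line J (option K) :=
    [ffun j => match l j with inl a => inl (Some a) | inr _ => inr tt end].
  exists (scomp s l').
    by apply: full_comp => // -[]; have [j lj] := fl tt; exists j; rewrite ffunE lj.
  suff colE b : chi (lpoint (scomp s l') b)
              = chi (point s [ffun j => Some (lpoint l (odflt a0 b) j)]).
    by move=> a b; rewrite !colE; apply: Hl.
  rewrite point_comp Hs; congr (chi (point s _)).
  by apply/ffunP=> j; rewrite !ffunE; case: (l j) => //= -[]; rewrite ?ffunE.
- have [I HI] := IHK C; exists I => chi.
  have [l fl Hl] := HI (fun w => chi [ffun i => f (w i)]).
  pose l' : line I K' := [ffun i => match l i with inl a => inl (f a) | inr _ => inr tt end].
  exists l'; first by case; have [j lj] := fl tt; exists j; rewrite ffunE lj.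
  suff colE b : lpoint l' b = [ffun i => f (lpoint l (g b) i)].
    by move=> a b; rewrite !colE.
  by apply/ffunP=> i; rewrite !ffunE; case: (l i) => // -[]; rewrite !ffunE gK.
Qed.

(** A letter of the alphabet [word J K] is a block of letters of [K], so a line over it is a
    [J]-dimensional subspace. *)
Theorem multidim_hales_jewett (K J C : finType) : exists I : finType,
  forall chi : word I K -> C, exists2 s : subspace I J K, full s &
    forall z z', chi (point s z) = chi (point s z').
Proof.
have [I HI] := hales_jewett (word J K) C.
exists (I * J)%type => chi.
have [l fl Hl] := HI (fun w => chi [ffun ij => w ij.1 ij.2]).
exists [ffun ij => match l ij.1 with inl w => inl (w ij.2) | inr _ => inr ij.2 end].
  by move=> j; have [i li] := fl tt; exists (i, j); rewrite ffunE li.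
move=> z z'; have := Hl z z'; congr (chi _ = chi _);
by apply/ffunP=> -[i j]; rewrite !ffunE /=; case: (l i) => // -[]; rewrite ffunE.
Qed.

(** Fixed letters differ from [None], so in a point [None] can only come from a variable. *)
Definition expand (I J K : finType) (s : subspace I J K) : subspace I J (option K) :=
  [ffun i => match s i with inl a => inl (Some a) | inr j => inr j end].

(* The constants [None] of the monochromatic subspace [s1] are tied to the new
   first coordinate, so they only occur where that coordinate is [None]. *)
Lemma tail_insensitive_subspace (K I0 J : finType) : forall C : finType,
  exists I : finType, forall chi : word I (option K) -> C,
    exists2 s : subspace I (I0 + J)%type K, full s &
      forall (u : word I0 (option K)) v v', (exists i, u i = None) ->
        chi (point (expand s) (wcat u v)) = chi (point (expand s) (wcat u v')).
Proof.
elim/finType_option_ind: I0 => [C|I0 IHI C|I0 I0' f [g fK gK] IHI C].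
- exists (void + J)%type => chi; exists [ffun i => inr i].
    by move=> j; exists j; rewrite ffunE.
  by move=> u v v' [[]].
- have [J' HJ'] := IHI {ffun K -> C}.
  have [M HM] := multidim_hales_jewett (option K) J' C.
  exists (option M) => chi.
  pose wcons b (x : word M (option K)) : word (option M) (option K) :=
    [ffun i => if i is Some i then x i else b].
  have [s1 fs1 Hs1] := HM (fun x => chi (wcons None x)).
  (* When the new coordinate is [Some a], the tied constants become [a]; the next colouring records
     all [a] at once. *)
  pose s1_ a : subspace M J' (option K) := [ffun i =>
    match s1 i with inl None => inl (Some a) | e => e end].
  have [s2 fs2 Hs2] := HJ' (fun x => [ffun a => chi (wcons (Some a) (point (s1_ a) x))]).
  pose s : subspace (option M) (option I0 + J)%type K := [ffun i =>
    if i is Some i then match s1 i with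
      | inl None => inr (inl None)
      | inl (Some a) => inl a
      | inr j => match s2 j with
         | inl a => inl a
         | inr (inl p) => inr (inl (Some p))
         | inr (inr q) => inr (inr q) end end
    else inr (inl None)].
  exists s.
    case=> [[p|]|q].
    + have [j s2j] := fs2 (inl p); have [i s1i] := fs1 j.
      by exists (Some i); rewrite ffunE s1i s2j.
    + by exists None; rewrite ffunE.
    + have [j s2j] := fs2 (inr q); have [i s1i] := fs1 j.
      by exists (Some i); rewrite ffunE s1i s2j.
  move=> u v v' [p up].
  (* If the new coordinate is a letter, [None] occurs later and the induction hypothesis applies; if
     it is [None], [s1] is monochromatic. *)
  case u0 : (u None) => [a|].
    have sE w : point (expand s) (wcat u w)
       = wcons (Some a) (point (s1_ a) (point (expand s2) (wcat [ffun p => u (Some p)] w))).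
      apply/ffunP=> -[i|]; rewrite !ffunE /=; last by rewrite ?ffunE.
      case: (s1 i) => [[b|]|j]; rewrite ?ffunE //.
      by case: (s2 j) => [b|[q|q]]; rewrite ?ffunE.
    rewrite !sE; case: p up => [p|] up; last by rewrite up in u0.
    have up' : exists p, [ffun p => u (Some p)] p = None by exists p; rewrite ffunE.
    by have /ffunP/(_ a) := Hs2 _ v v' up'; rewrite !ffunE.
  have sE w : point (expand s) (wcat u w)
     = wcons None (point s1 (point (expand s2) (wcat [ffun p => u (Some p)] w))).
    apply/ffunP=> -[i|]; rewrite !ffunE /=; last by rewrite ?ffunE.
    case: (s1 i) => [[b|]|j]; rewrite ?ffunE //.
    by case: (s2 j) => [b|[q|q]]; rewrite ?ffunE.
  by rewrite !sE; apply: Hs1.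
- have [I HI] := IHI C; exists I => chi; have [s fs Hs] := HI chi.
  pose t : subspace I (I0' + J)%type K := [ffun i => match s i with
    | inl a => inl a | inr (inl j) => inr (inl (f j)) | inr (inr q) => inr (inr q) end].
  have tE u w : point (expand t) (wcat u w) = point (expand s) (wcat [ffun j => u (f j)] w).
    by apply/ffunP=> i; rewrite !ffunE; case: (s i) => [a|[j|q]] //; rewrite !ffunE.
  exists t.
    case=> [j|q].
      by have [i si] := fs (inl (g j)); exists i; rewrite ffunE si gK.
    by have [i si] := fs (inr q); exists i; rewrite ffunE si.
  move=> u v v' [i ui]; rewrite !tE; apply: Hs.
  by exists (g i); rewrite ffunE gK.
Qed.

Local Open Scope ring_scope.

(** * Finite expectations *)

Section Expectation.
Variable R : archiRealFieldType.
Implicit Types (T U : finType).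

Definition esp T (p f : T -> R) : R := \sum_t p t * f t.

Definition prob T (p : T -> R) := (forall t, 0 <= p t) /\ \sum_t p t = 1.

Lemma eq_esp T (p f g : T -> R) : f =1 g -> esp p f = esp p g.
Proof. by move=> fg; apply: eq_bigr => t _; rewrite fg. Qed.

Lemma esp_le T (p f g : T -> R) : prob p -> (forall t, f t <= g t) -> esp p f <= esp p g.
Proof. by move=> [p0 _] fg; apply: ler_sum => t _; apply: ler_wpM2l. Qed.

Lemma espD T (p f g : T -> R) : esp p (fun t => f t + g t) = esp p f + esp p g.
Proof. by rewrite /esp -big_split; apply: eq_bigr => t _; rewrite mulrDr. Qed.

Lemma espZ T (p f : T -> R) c : esp p (fun t => c * f t) = c * esp p f.
Proof. by rewrite /esp mulr_sumr; apply: eq_bigr => t _; rewrite mulrCA. Qed.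

Lemma espB T (p f g : T -> R) : esp p (fun t => f t - g t) = esp p f - esp p g.
Proof. by rewrite /esp -sumrB; apply: eq_bigr => t _; rewrite mulrBr. Qed.

Lemma esp_cst T (p : T -> R) c : prob p -> esp p (fun=> c) = c.
Proof. by move=> [_ p1]; rewrite /esp -mulr_suml p1 mul1r. Qed.

Lemma esp_ge0 T (p f : T -> R) : prob p -> (forall t, 0 <= f t) -> 0 <= esp p f.
Proof. by move=> pp f0; rewrite -(esp_cst 0 pp); apply: esp_le. Qed.

Lemma esp_le1 T (p f : T -> R) : prob p -> (forall t, f t <= 1) -> esp p f <= 1.
Proof. by move=> pp f1; rewrite -(esp_cst 1 pp); apply: esp_le. Qed.

Lemma esp_exchange T U (p : T -> R) (q : U -> R) (f : T -> U -> R) :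
  esp p (fun t => esp q (f t)) = esp q (fun u => esp p (fun t => f t u)).
Proof.
rewrite /esp; under eq_bigr do rewrite mulr_sumr.
rewrite exchange_big; apply: eq_bigr => u _; rewrite mulr_sumr.
by apply: eq_bigr => t _; rewrite mulrCA.
Qed.

Definition pprod T U (p : T -> R) (q : U -> R) (tu : T * U) := p tu.1 * q tu.2.

Lemma esp_pprod T U (p : T -> R) (q : U -> R) (f : T * U -> R) :
  esp (pprod p q) f = esp p (fun t => esp q (fun u => f (t, u))).
Proof.
rewrite /esp; under [RHS]eq_bigr do rewrite mulr_sumr.
by rewrite pair_bigA; apply: eq_bigr => -[t u] _; rewrite /pprod /= mulrA.
Qed.

Lemma prob_pprod T U (p : T -> R) (q : U -> R) : prob p -> prob q -> prob (pprod p q).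
Proof.
move=> [p0 p1] [q0 q1]; split=> [[t u]|]; first exact: mulr_ge0.
rewrite -p1 -(pair_bigA _ (fun t u => pprod p q (t, u))) /=.
by apply: eq_bigr => t _; rewrite /pprod /= -mulr_sumr q1 mulr1.
Qed.

Lemma esp_markov T (p f : T -> R) (c : R) : prob p -> (forall t, f t <= 1) -> 0 <= c ->
  esp p f - c <= esp p (fun t => (c <= f t)%R%:R).
Proof.
move=> pp f1 c0; rewrite -[X in _ - X](esp_cst c pp) -espB; apply: esp_le => // t.
by case: (leP c (f t)) => [_|lt]; have := f1 t; rewrite /= ?mulr1n ?mulr0n; lra.
Qed.

(** Union bound over the events [G u]. *)
Lemma esp_pigeonhole T U (p : T -> R) (c : R) (G : U -> T -> bool) : prob p -> 0 < c ->
  c <= esp p (fun t => [exists u, G u t]%:R) ->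
  exists u, c / #|U|%:R <= esp p (fun t => (G u t)%:R).
Proof.
move=> pp c0 cle.
have sumG : c <= \sum_u esp p (fun t => (G u t)%:R).
  apply: le_trans cle _; rewrite exchange_big; apply: ler_sum => t _.
  rewrite -mulr_sumr; apply: ler_wpM2l; first by case: pp.
  case: existsP => [[u Gu]|_]; last exact: sumr_ge0.
  by rewrite (bigD1 u) //= Gu lerDl sumr_ge0.
case: (pickP (fun u => c / #|U|%:R <= esp p (fun t => (G u t)%:R))) => [u ?|small].
  by exists u.
have U0 : (0 < #|U|)%N.
  case: (posnP #|U|) => // /card0_eq U0; move: sumG.
  rewrite big_pred0; last by move=> u; have := U0 u.
  by rewrite leNgt c0.
have : \sum_u esp p (fun t => (G u t)%:R) < \sum_(u : U) c / #|U|%:R.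
  have /card_gt0P [u0 _] := U0.
  apply: ltr_sum; first by apply/hasP; exists u0; rewrite ?mem_index_enum.
  by move=> u _; rewrite ltNge small.
rewrite sumr_const -[X in _ < X]mulr_natr divfK ?pnatr_eq0 -?lt0n // => lt.
by have := le_lt_trans sumG lt; rewrite ltxx.
Qed.

Lemma esp_exists T (p f : T -> R) c : prob p -> c <= esp p f -> exists t, c <= f t.
Proof.
move=> pp cf; case: (pickP (fun t => c <= f t)) => [t ?|small]; first by exists t.
have lt t : f t < c by rewrite ltNge small.
suff p0 t : p t = 0.
  by case: pp => _ /eqP; rewrite big1 // eq_sym oner_eq0.
have ge0 u : 0 <= p u * (c - f u).
  by rewrite mulr_ge0 ?(proj1 pp) // subr_ge0 ltW.
have : p t * (c - f t) <= 0.
  apply: le_trans (_ : esp p (fun t => c - f t) <= 0); last first.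
    by rewrite espB (esp_cst c pp) subr_le0.
  by rewrite /esp (bigD1 t) //= lerDl sumr_ge0.
rewrite pmulr_lle0 ?subr_gt0 // => pt.
by apply/eqP; rewrite eq_le pt (proj1 pp).
Qed.

End Expectation.

(** * Uniform averages over words *)

Section Uniform.
Variable R : archiRealFieldType.
Implicit Types T U : finType.

Definition unif T : T -> R := fun=> #|T|%:R^-1.

Lemma prob_unif T : (0 < #|T|)%N -> prob (@unif T).
Proof.
move=> T0; split=> [t|]; first by rewrite invr_ge0 ler0n.
by rewrite /unif sumr_const -[LHS]mulr_natl divff // pnatr_eq0 -lt0n.
Qed.

Lemma esp_bij T U (h : T -> U) (f : U -> R) : bijective h ->
  esp (@unif U) f = esp (@unif T) (fun t => f (h t)).
Proof.
move=> bh; rewrite /esp /unif (bij_eq_card bh).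
by rewrite (reindex h) //; apply: onW_bij.
Qed.

Lemma pprod_unif T U : pprod (@unif T) (@unif U) =1 @unif (T * U)%type.
Proof. by move=> tu; rewrite /pprod /unif card_prod natrM invfM. Qed.

Lemma esp_unif_pair T U (f : T * U -> R) :
  esp (@unif (T * U)%type) f = esp (@unif T) (fun t => esp (@unif U) (fun u => f (t, u))).
Proof. by rewrite -esp_pprod; apply: eq_bigr => tu _; rewrite pprod_unif. Qed.

Lemma esp_wcat (I J K : finType) (f : word (I + J)%type K -> R) :
  esp (@unif _) f = esp (@unif _) (fun x => esp (@unif _) (fun y => f (wcat x y))).
Proof.
rewrite -(esp_unif_pair (fun xy => f (wcat xy.1 xy.2))).
pose split_word (w : word (I + J)%type K) : word I K * word J K :=
  ([ffun i => w (inl i)], [ffun j => w (inr j)]).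
apply: (esp_bij (h := fun xy => wcat xy.1 xy.2)).
exists split_word => [[x y]|w]; last by apply/ffunP=> -[i|j]; rewrite !ffunE.
by congr pair; apply/ffunP=> i; rewrite !ffunE.
Qed.

(** The indicator is a product over coordinates, so the sum factors: [i] contributes 1 and every
    other coordinate [#|Q|]. *)
Lemma esp_marginal (I Q : finType) (i : I) (q : Q) :
  esp (@unif (word I Q)) (fun x => (x i == q)%:R) = #|Q|%:R^-1.
Proof.
rewrite /esp -mulr_sumr /unif.
pose h j (b : Q) : R := if j == i then (b == q)%:R else 1.
rewrite (eq_bigr (fun x : word I Q => \prod_j h j (x j))); last first.
  move=> x _; rewrite (bigD1 i) //= {1}/h eqxx big1 ?mulr1 // => j /negPf ji.
  by rewrite /h ji.
rewrite -bigA_distr_bigA (bigD1 i) //=.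
have -> : \sum_b h i b = 1.
  rewrite (bigD1 q) //= /h !eqxx big1 ?addr0 // => b /negPf->; by [].
rewrite mul1r (eq_bigr (fun=> #|Q|%:R)); last first.
  by move=> j /negPf ji; rewrite /h ji sumr_const.
have Q0 : #|Q|%:R != 0 :> R by rewrite pnatr_eq0 -lt0n; apply/card_gt0P; exists q.
rewrite prodr_const card_ffun natrX; have -> : #|I| = #|[pred j | j != i]|.+1.
  by rewrite (cardD1 i) inE add1n; congr _.+1; apply: eq_card => j; rewrite !inE andbT.
by rewrite exprS invfM mulfVK // expf_neq0.
Qed.

End Uniform.

(** * Probabilistic forms of the density Hales-Jewett theorem *)

Section Density.
Variable R : archiRealFieldType.

Local Notation avg f := (esp (@unif R _) f).

Definition DHJ_at (K : finType) (d : R) := exists I : finType,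
  forall A : pred (word I K), d <= avg (fun x => (A x)%:R) ->
    exists2 l : line I K, full l & forall a, A (lpoint l a).

Definition DHJ (K : finType) := forall d, 0 < d -> DHJ_at K d.

Lemma fullP (I J K : finType) (s : subspace I J K) :
  reflect (full s) [forall j, exists i, s i == inr j].
Proof.
apply: (iffP forallP) => fs j; first by have /existsP[i /eqP] := fs j; exists i.
by have [i si] := fs j; apply/existsP; exists i; apply/eqP.
Qed.

Lemma ler_bool (b1 b2 : bool) : (b1 -> b2) -> b1%:R <= b2%:R :> R.
Proof. by move=> b12; rewrite ler_nat; case: b1 b12 => // ->. Qed.

Lemma card_word_gt0 (I K : finType) (a : K) : (0 < #|word I K|)%N.
Proof. by apply/card_gt0P; exists [ffun=> a]. Qed.

(** By Markov's inequality, with probability at least [d / 2] the set of [w] with [B w t] has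
    density at least [d / 2] and contains a line; as there are finitely many lines, one of them
    occurs with probability at least [th]. *)
Lemma events_DHJ (K : finType) (a0 : K) (d : R) : DHJ K -> 0 < d ->
  exists (I : finType) (th : R), 0 < th /\
  forall (T : finType) (p : T -> R) (B : word I K -> T -> bool), prob p ->
    d <= avg (fun w => esp p (fun t => (B w t)%:R)) ->
    exists2 l : line I K, full l & th <= esp p (fun t => [forall a, B (lpoint l a) t]%:R).
Proof.
move=> dhj d0; have d2 : 0 < d / 2 by lra.
have [I HI] := dhj _ d2.
have L0 : 0 < #|line I K|%:R :> R.
  by rewrite ltr0n; apply/card_gt0P; exists [ffun=> inr tt].
exists I, (d / 2 / #|line I K|%:R); split=> [|T p B pp dB]; first exact: divr_gt0.
rewrite esp_exchange in dB.
pose G (l : line I K) t := [forall j, exists i, l i == inr j] && [forall a, B (lpoint l a) t].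
have le1 t : avg (fun w => (B w t)%:R) <= 1.
  apply: esp_le1 => [|w]; first exact: prob_unif (card_word_gt0 _ a0).
  exact: (@ler_bool _ true).
have dM := esp_markov pp le1 (ltW d2).
have [] := @esp_pigeonhole R T _ p (d / 2) G pp d2.
  apply: le_trans (le_trans _ dM) _; first by lra.
  apply: esp_le => // t; apply: ler_bool => /HI[l fl Bl].
  apply/existsP; exists l; apply/andP; split; first exact/fullP.
  exact/forallP.
move=> l Hl; exists l.
  apply/fullP; apply: contraLR isT => nfl; move: Hl.
  rewrite (eq_esp _ (g := fun=> 0)); last by move=> t; rewrite /G (negPf nfl).
  by rewrite (esp_cst 0 pp) leNgt divr_gt0.
apply: le_trans Hl _; apply: esp_le => // t.
by apply: ler_bool => /andP[].
Qed.

(** One variable at a time: the one-dimensional case is applied with the remaining word as part of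
    the random point, and the induction hypothesis to the event that the whole line lies in [B]. *)
Lemma events_multidim_DHJ (K : finType) (a0 : K) (J : finType) : DHJ K ->
  forall d : R, 0 < d -> exists (I : finType) (th : R), 0 < th /\
  forall (T : finType) (p : T -> R) (B : word I K -> T -> bool), prob p ->
    d <= avg (fun w => esp p (fun t => (B w t)%:R)) ->
    exists2 s : subspace I J K, full s &
      th <= esp p (fun t => [forall z, B (point s z) t]%:R).
Proof.
move=> dhj; elim/finType_option_ind: J => [d d0|J IHJ d d0|J J' f [g fK gK] IHJ d d0].
- exists void, d; split=> // T p B pp dB.
  exists [ffun i : void => match i with end]; first by case.
  have uW := prob_unif R (card_word_gt0 void a0).
  apply: le_trans dB _; rewrite -[leRHS](esp_cst _ uW).
  apply: esp_le => // w; apply: esp_le => // t; apply: ler_bool => Bw.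
  by apply/forallP=> z; move: Bw; congr (is_true (B _ t)); apply/ffunP; case.
- have [I1 [th1 [th10 H1]]] := events_DHJ a0 dhj d0.
  have [I2 [th [th0 H2]]] := IHJ _ th10.
  exists (I1 + I2)%type, th; split=> // T p B pp dB.
  have uI2 := prob_unif R (card_word_gt0 I2 a0).
  have [|l fl Hl] := H1 _ _ (fun w wt => B (wcat w wt.1) wt.2) (prob_pprod uI2 pp).
    apply: le_trans dB _; rewrite esp_wcat; apply: esp_le => [|w].
      exact: prob_unif (card_word_gt0 _ a0).
    by rewrite esp_pprod.
  rewrite esp_pprod in Hl.
  have [s fs Hs] := H2 _ _ (fun w t => [forall a, B (wcat (lpoint l a) w) t]) pp Hl.
  exists [ffun i => match i with
    | inl i => match l i with inl a => inl a | inr _ => inr None end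
    | inr i => match s i with inl a => inl a | inr j => inr (Some j) end end].
    case=> [j|]; [have [i si] := fs j | have [i li] := fl tt].
      by exists (inr i); rewrite ffunE si.
    by exists (inl i); rewrite ffunE li.
  apply: le_trans Hs _; apply: esp_le => // t; apply: ler_bool => /forallP Bz.
  apply/forallP=> z; have /forallP/(_ (z None)) := Bz [ffun j => z (Some j)].
  congr (is_true (B _ t)); apply/ffunP=> -[i|i]; rewrite !ffunE.
    by case: (l i) => // j; rewrite ffunE.
  by case: (s i) => // j; rewrite ffunE.
- have [I [th [th0 H]]] := IHJ d d0; exists I, th; split=> // T p B pp dB.
  have [s fs Hs] := H T p B pp dB.
  exists [ffun i => match s i with inl a => inl a | inr j => inr (f j) end].
    by move=> j; have [i si] := fs (g j); exists i; rewrite ffunE si gK.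
  apply: le_trans Hs _; apply: esp_le => // t; apply: ler_bool => /forallP Bz.
  apply/forallP=> z; have := Bz [ffun j => z (f j)].
  congr (is_true (B _ t)); apply/ffunP=> i; rewrite !ffunE.
  by case: (s i) => // j; rewrite ffunE.
Qed.

(** * Insensitive sets *)

(** Words agree up to exchanges of [None] and [a] exactly when their folds agree. *)
Definition insensitive (K : finType) (a : K) (I : finType) (P : pred (word I (option K))) :=
  forall x, P (fold_None a x) = P x.

Lemma fold_point (I J K : finType) (a : K) (s : subspace I J (option K)) z :
  fold_None a (point s (fold_None a z)) = fold_None a (point s z).
Proof. by apply/ffunP=> i; rewrite !ffunE; case: (s i) => // j; rewrite ffunE. Qed.

Lemma insensitive_point (I J K : finType) (a : K) (s : subspace I J (option K)) P :
  insensitive a P -> insensitive a (fun z => P (point s z)).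
Proof. by move=> iP z; rewrite -iP fold_point iP. Qed.

Section ReplaceLetter.
Variables (B K : finType).
Implicit Types (q : word B (option K)) (c : K).

Definition first_letter q := [pick b | q b != None].

Definition replace_letter q c : word B (option K) :=
  [ffun b => if Some b == first_letter q then Some c else q b].

(** Recording the overwritten letter makes [(q, c) |-> (replace_letter q c, old_letter q c)] an
    involution; a pair in which [q] is all [None] is fixed. *)
Definition old_letter q c : K :=
  if first_letter q is Some b then odflt c (q b) else c.

Lemma first_letterP q b : first_letter q = Some b -> q b != None.
Proof. by rewrite /first_letter; case: pickP => // b' qb' [<-]. Qed.

Lemma first_letter_replace q c : first_letter (replace_letter q c) = first_letter q.
Proof.
apply: eq_pick => b; rewrite ffunE; case: ifP => // /eqP/esym fq.
by rewrite (first_letterP fq).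
Qed.

Lemma replace_letterK q c : replace_letter (replace_letter q c) (old_letter q c) = q.
Proof.
apply/ffunP=> b; rewrite ffunE first_letter_replace ffunE.
case: (Some b =P first_letter q) => [/esym fq|//]; have := first_letterP fq.
by rewrite /old_letter fq; case: (q b).
Qed.

Lemma old_letterK q c : old_letter (replace_letter q c) (old_letter q c) = c.
Proof.
rewrite /old_letter first_letter_replace.
by case fq: (first_letter q) => [b|//]; rewrite ffunE fq eqxx.
Qed.

End ReplaceLetter.

(* Replacing the first letter other than [None] of each row by a uniform letter of [K]
   preserves the uniform measure, which is how a dense set over [option K] gives a dense
   family of events indexed by words over [K]. *)
Lemma insensitive_events_DHJ (K : finType) (a : K) (J : finType) (d : R) : DHJ K -> 0 < d ->
  exists (I : finType) (th : R), 0 < th /\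
  forall (T : finType) (p : T -> R) (B : word I (option K) -> T -> bool), prob p ->
    (forall t, insensitive a (B^~ t)) ->
    d <= avg (fun w => esp p (fun t => (B w t)%:R)) ->
    exists2 s : subspace I J (option K), full s &
      th <= esp p (fun t => [forall z, B (point s z) t]%:R).
Proof.
move=> dhj d0; have d2 : 0 < d / 2 by lra.
have [I0 [th [th0 H]]] := events_multidim_DHJ a J dhj d2.
(* Rows have length [n], so [#|Q|] is at least [2 ^ n > n], and a uniform word has an all-[None] row
   with probability at most [#|I0| / #|Q|], hence at most [d / 2]. *)
pose n := Num.bound (#|I0|%:R / (d / 2)).
pose Q : finType := word 'I_n (option K).
have bad_le : #|I0|%:R / #|Q|%:R <= d / 2.
  have Q0 : 0 < #|Q|%:R :> R by rewrite ltr0n (card_word_gt0 _ None).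
  rewrite ler_pdivrMr // mulrC -ler_pdivrMr //.
  have /ltW/le_trans -> // : #|I0|%:R / (d / 2) < n%:R.
    by apply: archi_boundP; rewrite divr_ge0 ?ler0n // ltW.
  rewrite ler_nat /Q card_ffun card_ord card_option; apply/ltnW/ltn_expl.
  by rewrite ltnS; apply/card_gt0P; exists a.
exists (I0 * 'I_n)%type, th; split=> // T p B pp iB dB.
pose flat (x : word I0 Q) : word (I0 * 'I_n)%type (option K) := [ffun ib => x ib.1 ib.2].
have bflat : bijective flat.
  pose rows (w : word (I0 * 'I_n)%type (option K)) : word I0 Q :=
    [ffun i => [ffun b => w (i, b)]].
  exists rows => [x|w].
    by apply/ffunP=> i; apply/ffunP=> b; rewrite !ffunE.
  by apply/ffunP=> -[i b]; rewrite !ffunE.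
pose good (x : word I0 Q) := [forall i, x i != [ffun=> None]].
have uX : prob (@unif R (word I0 Q)) by apply: prob_unif (card_word_gt0 _ [ffun=> None]).
have uW : prob (@unif R (word I0 K)) by apply: prob_unif (card_word_gt0 _ a).
have d2B : d / 2 <= avg (fun x => esp p (fun t => (good x && B (flat x) t)%:R)).
  rewrite (esp_bij _ bflat) in dB.
  have badE : avg (fun x => (~~ good x)%:R) <= d / 2.
    apply: le_trans bad_le.
    have -> : #|I0|%:R / #|Q|%:R = \sum_i avg (fun x : word I0 Q => (x i == [ffun=> None])%:R).
      by under eq_bigr do rewrite esp_marginal; rewrite sumr_const mulr_natl.
    rewrite exchange_big; apply: ler_sum => x _; rewrite -mulr_sumr.
    apply: ler_wpM2l; first by case: uX.
    rewrite negb_forall; case: existsP => [[i]|_]; last exact: sumr_ge0.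
    by rewrite negbK (bigD1 i) //= => ->; rewrite lerDl sumr_ge0.
  suff : avg (fun x => esp p (fun t => (B (flat x) t)%:R)) <=
      avg (fun x => (~~ good x)%:R)
      + avg (fun x => esp p (fun t => (good x && B (flat x) t)%:R)) by lra.
  rewrite -espD; apply: esp_le => // x; rewrite -[X in X + _](esp_cst _ pp) -espD.
  apply: esp_le => // t; case: (good x); rewrite /= ?add0r ?addr0 //.
  exact: (@ler_bool _ true).
pose repl (x : word I0 Q) (w : word I0 K) : word I0 Q := [ffun i => replace_letter (x i) (w i)].
pose F (w : word I0 K) (xt : word I0 Q * T) :=
  good (repl xt.1 w) && B (flat (repl xt.1 w)) xt.2.
have [|s0 fs0 Hs0] := H _ _ F (prob_pprod uX pp).
  apply: le_trans d2B _.
  pose G x := esp p (fun t => (good x && B (flat x) t)%:R).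
  have -> : avg (fun w => esp (pprod (@unif R _) p) (fun xt => (F w xt)%:R))
      = avg (fun xw : word I0 Q * word I0 K => G (repl xw.1 xw.2)).
    by rewrite esp_unif_pair [RHS]esp_exchange; apply: eq_esp => w; rewrite esp_pprod.
  (* [swap] is its own inverse, so [repl x w] is uniform when [x] and [w] are. *)
  pose swap (xw : word I0 Q * word I0 K) : word I0 Q * word I0 K :=
    (repl xw.1 xw.2, [ffun i => old_letter (xw.1 i) (xw.2 i)]).
  have bswap : bijective swap.
    by exists swap => -[x w]; congr pair; apply/ffunP=> i;
      rewrite !ffunE ?replace_letterK ?old_letterK.
  rewrite -(esp_bij (fun xw => G xw.1) bswap) esp_unif_pair.
  by apply: esp_le => // x; rewrite /= (esp_cst _ uW).
rewrite esp_pprod in Hs0; have [x Hx] := esp_exists uX Hs0.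
(* In row [i] the replaced letter becomes the variable [i]; everything else is frozen as in [x]. *)
pose sx : subspace (I0 * 'I_n)%type I0 (option K) := [ffun ib =>
  if Some ib.2 == first_letter (x ib.1) then inr ib.1 else inl (x ib.1 ib.2)].
have sxE w : flat (repl x w) = point sx [ffun i => Some (w i)].
  by apply/ffunP=> -[i b]; rewrite !ffunE /=; case: ifP => //; rewrite ffunE.
(* A positive probability gives a [t] in the event, and there [good] excludes all-[None] rows. *)
have gx i : exists b, first_letter (x i) = Some b.
  have [t] := esp_exists pp Hx; case: forallP => [/(_ [ffun=> a])|_]; last first.
    by rewrite leNgt th0.
  case/andP=> /forallP/(_ i) + _ _; rewrite ffunE /replace_letter.
  case fx: (first_letter _) => [b|]; first by exists b.
  case/eqP; apply/ffunP=> b; rewrite !ffunE /=.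
  by move: fx; rewrite /first_letter; case: pickP => // /(_ b)/negbFE/eqP.
exists (scomp sx (expand s0)).
  apply: full_comp => [i|j].
    by have [b xb] := gx i; exists (i, b); rewrite ffunE /= xb eqxx.
  by have [i si] := fs0 j; exists i; rewrite ffunE si.
apply: le_trans Hx _; apply: esp_le => // t; apply: ler_bool => /forallP Bz.
apply/forallP=> z; have /andP[_ /= Bx] := Bz [ffun j => odflt a (z j)].
rewrite sxE -(iB t) in Bx; rewrite point_comp -(iB t); move: Bx.
congr (is_true (B _ t)).
apply/ffunP=> ib; rewrite !ffunE; case: ifP => // _; rewrite !ffunE.
by case: (s0 _) => // j; rewrite ffunE.
Qed.

End Density.

(** * Correlation with insensitive sets *)

Section Correlation.
Variable R : archiRealFieldType.

Local Notation avg f := (esp (@unif R _) f).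

(** [point s] is injective for full [s], so a sum over its image is a sum over [z]; the factor is
    the density of the image. *)
Lemma avg_image (I J K : finType) (s : subspace I J K) (g : word I K -> R) : full s ->
  avg (fun x => [exists z, point s z == x]%:R * g x)
  = #|word J K|%:R / #|word I K|%:R * avg (fun z => g (point s z)).
Proof.
move=> fs; rewrite /esp -!mulr_sumr /unif; case: (posnP #|word J K|) => [J0|J0].
  rewrite J0 !mul0r big1 ?mulr0 // => x _; case: existsP => [[z _]|_].
    by have := card0_eq J0 z.
  by rewrite mul0r.
rewrite mulrAC mulrA divff ?mul1r ?pnatr_eq0 -?lt0n // [RHS]mulrC; congr (_ * _).
rewrite -(big_imset _ (in2W (point_inj fs))) /= [RHS]big_mkcond /=.
apply: eq_bigr => x _.
have -> : [exists z, point s z == x] = (x \in [set point s z | z in predT]).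
  by apply/existsP/imsetP => [[z /eqP <-]|[z _ ->]]; exists z.
by case: ifP => _; rewrite ?mul1r ?mul0r.
Qed.

(** In the application [f] is an indicator minus a threshold: no such subspace sees a density above
    the threshold. *)
Definition nonpos_on_subspaces (I J K : finType) (f : word I K -> R) :=
  forall s : subspace I J K, full s -> avg (fun z => f (point s z)) <= 0.

Definition padr (I I' J K : finType) (s : subspace I J K) (y : word I' K) :
  subspace (I + I')%type J K := [ffun i => match i with inl i => s i | inr i => inl (y i) end].

Definition padl (I I' J K : finType) (x : word I' K) (s : subspace I J K) :
  subspace (I' + I)%type J K := [ffun i => match i with inl i => inl (x i) | inr i => s i end].

Lemma point_padr (I I' J K : finType) (s : subspace I J K) (y : word I' K) z :
  point (padr s y) z = wcat (point s z) y.
Proof. by apply/ffunP=> -[i|i]; rewrite !ffunE. Qed.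

Lemma point_padl (I I' J K : finType) (x : word I' K) (s : subspace I J K) z :
  point (padl x s) z = wcat x (point s z).
Proof. by apply/ffunP=> -[i|i]; rewrite !ffunE. Qed.

Lemma full_padr (I I' J K : finType) (s : subspace I J K) (y : word I' K) :
  full s -> full (padr s y).
Proof. by move=> fs j; have [i si] := fs j; exists (inl i); rewrite ffunE. Qed.

Lemma full_padl (I I' J K : finType) (x : word I' K) (s : subspace I J K) :
  full s -> full (padl x s).
Proof. by move=> fs j; have [i si] := fs j; exists (inr i); rewrite ffunE. Qed.

Lemma insensitive_wcat (I I' K : finType) (a : K) (x : word I (option K))
    (P : pred (word (I + I')%type (option K))) :
  insensitive a P -> insensitive a (fun y => P (wcat x y)).
Proof.
move=> iP y; rewrite -iP -[RHS]iP; congr P.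
by apply/ffunP=> -[i|i]; rewrite !ffunE.
Qed.

(* Greedy exhaustion: as long as [P] is dense it contains a product [W * Y] of a [J]-dimensional
   subspace and a dense set; [f] has nonpositive mean there, and what is left of [P] is still
   insensitive in the remaining coordinates. *)
Lemma insensitive_correlation (K : finType) (a : K) (J : finType) (b : R) : DHJ R K -> 0 < b ->
  exists I : finType, forall f : word I (option K) -> R, (forall x, f x <= 1) ->
    nonpos_on_subspaces J f -> forall P, insensitive a P ->
    avg (fun x => (P x)%:R * f x) <= b.
Proof.
move=> dhj b0; have b2 : 0 < b / 2 by lra.
have [M [th [th0 HM]]] := insensitive_events_DHJ a J dhj b2.
have uW I := prob_unif R (card_word_gt0 I (None : option K)).
have X0 : 0 < #|word M (option K)|%:R :> R by rewrite ltr0n (card_word_gt0 _ None).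
(* Each round removes mass at least [c]: [Y] has measure at least [th], and the subspace [W]
   contains at least one word. *)
pose c := th / #|word M (option K)|%:R; have c0 : 0 < c by apply: divr_gt0.
suff step (t : nat) : exists I : finType, forall f : word I (option K) -> R,
    (forall x, f x <= 1) -> nonpos_on_subspaces J f -> forall P, insensitive a P ->
    avg (fun x => (P x)%:R * f x) <= b / 2 + avg (fun x => (P x)%:R) / (1 + c * t%:R).
  (* After so many rounds [c * t * (b / 2) > 1], and the second term is at most [b / 2]. *)
  pose t := Num.bound (c * (b / 2))^-1.
  have [I HI] := step t; exists I => f f1 nf P iP; apply: le_trans (HI f f1 nf P iP) _.
  have cb : 0 < c * (b / 2) by apply: mulr_gt0.
  have lt_t : (c * (b / 2))^-1 < t%:R.
    by apply: archi_boundP; rewrite invr_ge0 ltW.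
  have ct : 1 < c * t%:R * (b / 2).
    by rewrite mulrAC -ltr_pdivrMl // mulr1.
  have P1 : avg (fun x => (P x)%:R) <= 1.
    by apply: esp_le1 => // x; apply: (@ler_bool _ _ true).
  have ct0 : 0 < 1 + c * t%:R by rewrite ltr_pwDl // mulr_ge0 ?ler0n ?ltW.
  suff : avg (fun x => (P x)%:R) / (1 + c * t%:R) <= b / 2 by lra.
  by rewrite ler_pdivrMr //; nra.
elim: t => [|t [I HI]].
  exists void => f f1 nf P iP; rewrite mulr0 addr0 divr1.
  apply: le_trans (_ : avg (fun x => (P x)%:R) <= _); last by lra.
  by apply: esp_le => // x; rewrite ler_piMr ?ler0n.
exists (M + I)%type => f f1 nf P iP.
have ct0 (n : nat) : 0 < 1 + c * n%:R by rewrite ltr_pwDl // mulr_ge0 ?ler0n ?ltW.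
have P0 : 0 <= avg (fun x => (P x)%:R) by apply: esp_ge0.
have P1 : avg (fun x => (P x)%:R) <= 1.
  by apply: esp_le1 => // x; apply: (@ler_bool _ _ true).
case: (leP (avg (fun x => (P x)%:R)) (b / 2)) => [small|/ltW large].
  apply: le_trans (_ : avg (fun x => (P x)%:R) <= _).
    by apply: esp_le => // x; rewrite ler_piMr ?ler0n.
  have : 0 <= avg (fun x => (P x)%:R) / (1 + c * t.+1%:R) by rewrite divr_ge0 // ltW.
  lra.
have [||s fs Hs] := HM _ _ (fun x y => P (wcat x y)) (uW I).
- move=> y x; rewrite -iP -[RHS]iP; congr P.
  by apply/ffunP=> -[i|i]; rewrite !ffunE.
- by rewrite -(esp_wcat (fun w => (P w)%:R)).
pose Y y := [forall z, P (wcat (point s z) y)].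
pose im x := [exists z, point s z == x].
pose P' x y := P (wcat x y) && ~~ (im x && Y y).
have PE x y : (P (wcat x y))%:R = (im x)%:R * (Y y)%:R + (P' x y)%:R :> R.
  rewrite /P' -natrM mulnb; case: (boolP (im x && Y y)) => [|_]; last first.
    by rewrite andbT add0r.
  case/andP=> /existsP[z /eqP <-] /forallP/(_ z) ->.
  by rewrite andbF addr0.
have YI : insensitive a Y.
  move=> y; apply: eq_forallb => z.
  exact: (insensitive_wcat (point s z) iP).
have P'I x : insensitive a (P' x).
  by move=> y; rewrite /P' YI (insensitive_wcat x iP).
have le_first : avg (fun x => avg (fun y => (im x)%:R * (Y y)%:R * f (wcat x y))) <= 0.
  rewrite esp_exchange -(esp_cst 0 (uW I)); apply: esp_le => // y.
  rewrite (eq_esp _ (g := fun x => (Y y)%:R * ((im x)%:R * f (wcat x y)))); last first.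
    by move=> x; rewrite mulrA [_ * (im x)%:R]mulrC.
  rewrite espZ (avg_image (fun x => f (wcat x y)) fs).
  rewrite mulr_ge0_le0 ?ler0n // mulr_ge0_le0 ?divr_ge0 ?ler0n //.
  have := nf _ (full_padr y fs).
  by under eq_esp => z do rewrite point_padr.
have le_second : avg (fun x => avg (fun y => (P' x y)%:R * f (wcat x y)))
    <= b / 2 + avg (fun x => avg (fun y => (P' x y)%:R)) / (1 + c * t%:R).
  rewrite -[X in X + _](esp_cst _ (uW M)) [X in _ + X]mulrC -espZ -espD; apply: esp_le => // x.
  rewrite [X in _ + X]mulrC; apply: HI => // s' fs'.
  have := nf _ (full_padl x fs').
  by under eq_esp => z do rewrite point_padl.
have P'le : avg (fun x => avg (fun y => (P' x y)%:R)) <= avg (fun x => (P x)%:R) - c.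
  rewrite [X in _ <= X - _]esp_wcat.
  under [X in _ <= X - _]eq_esp => x do under eq_esp => y do rewrite PE.
  under [X in _ <= X - _]eq_esp => x do rewrite espD espZ.
  rewrite espD; suff : c <= avg (fun x => (im x)%:R * avg (fun y => (Y y)%:R)) by lra.
  rewrite (avg_image _ fs) esp_cst // /c [leRHS]mulrAC.
  rewrite ler_pM2r ?invr_gt0 // -[th]mul1r; apply: ler_pM => //; first exact: ltW.
  by rewrite ler1n (card_word_gt0 _ None).
rewrite esp_wcat.
under eq_esp => x do under eq_esp => y do rewrite PE mulrDl.
under eq_esp => x do rewrite espD.
rewrite espD; apply: le_trans (lerD le_first le_second) _.
rewrite add0r lerD2l ler_pdivrMr // mulrAC ler_pdivlMr //.
set p := avg _ in P0 P1 P'le *; set p' := avg _ in P'le *.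
(* From [p' <= p - c] and [p <= 1] follows [p' * (1 + c * (t + 1)) <= p * (1 + c * t)], which
   explains the denominator in the bound. *)
have t0 : 0 <= c * t%:R by rewrite mulr_ge0 ?ler0n // ltW.
have cc : 0 <= c * c by rewrite mulr_ge0 // ltW.
have := ct0 t; have := ct0 t.+1; rewrite -natr1 mulrDr mulr1; nra.
Qed.

End Correlation.

(** * The induction on the alphabet *)

Section DensityIncrement.
Variable R : archiRealFieldType.

Local Notation avg f := (esp (@unif R _) f).

(* [1 - u_a * v = (1 - u_a) + u_a * (1 - v)] peels off one insensitive factor at a time. *)
Lemma insensitive_product_correlation (K : finType) (l : seq K) : DHJ R K ->
  forall (J : finType) (b : R), 0 < b ->
  exists I : finType, forall f : word I (option K) -> R, (forall x, f x <= 1) ->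
    nonpos_on_subspaces J f ->
    forall P : K -> pred (word I (option K)), (forall a, insensitive a (P a)) ->
    avg f <= b /\ avg (fun x => (~~ all (fun a => P a x) l)%:R * f x) <= b.
Proof.
move=> dhj; elim: l => [|a l IHl] J b b0.
  exists J => f f1 nf P iP; split.
    have fid : full ([ffun j => inr j] : subspace J J (option K)).
      by move=> j; exists j; rewrite ffunE.
    apply: le_trans (le_trans _ (nf _ fid)) (ltW b0).
    rewrite le_eqVlt; apply/orP; left; apply/eqP; apply: eq_esp => x; congr f.
    by apply/ffunP=> j; rewrite !ffunE.
  rewrite (eq_esp _ (g := fun=> 0)); last by move=> x; rewrite mul0r.
  by rewrite esp_cst ?ltW //; apply: prob_unif (card_word_gt0 _ None).
have b3 : 0 < b / 3 by lra.
have [J' HJ'] := IHl J _ b3.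
have [I HI] := insensitive_correlation a J' dhj b3.
exists I => f f1 nf P iP.
have uW (I0 : finType) := prob_unif R (card_word_gt0 I0 (None : option K)).
pose N x : R := (~~ all (fun a => P a x) l)%:R.
(* The induction hypothesis inside [J']-dimensional subspaces makes the means of [f - b / 3] and
   [N * f - b / 3] nonpositive there, so both can be tested against sets insensitive for [a]. *)
have restr (s : subspace I J' (option K)) : full s ->
    avg (fun z => f (point s z)) <= b / 3 /\
    avg (fun z => N (point s z) * f (point s z)) <= b / 3.
  move=> fs; apply: (HJ' (fun z => f (point s z)) _ _ (fun c z => P c (point s z))) => //.
    move=> t ft; have := nf _ (full_comp fs ft).
    by under eq_esp => z do rewrite point_comp.
  by move=> c; apply: insensitive_point.
have HF Q : insensitive a Q -> avg (fun x => (Q x)%:R * (f x - b / 3)) <= b / 3.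
  apply: HI => [x|s fs]; first by have := f1 x; lra.
  by rewrite espB esp_cst // subr_le0; case: (restr s fs).
have HG Q : insensitive a Q -> avg (fun x => (Q x)%:R * (N x * f x - b / 3)) <= b / 3.
  apply: HI => [x|s fs].
    by have := f1 x; rewrite /N; case: (~~ _); rewrite ?mul1r ?mul0r; lra.
  by rewrite espB esp_cst // subr_le0; case: (restr s fs).
split.
  have := HF predT (fun=> erefl); under eq_esp => x do rewrite mul1r.
  by rewrite espB esp_cst //; lra.
have iC : insensitive a (fun x => ~~ P a x) by move=> x; rewrite iP.
have Hsum := lerD (HF _ iC) (HG _ (iP a)).
(* [P a] and its complement partition the space, so the subtracted terms add up to a single
   [b / 3]. *)
have -> : avg (fun x => (~~ all (fun a => P a x) (a :: l))%:R * f x)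
    = avg (fun x => (~~ P a x)%:R * (f x - b / 3) + (P a x)%:R * (N x * f x - b / 3) + b / 3).
  apply: eq_esp => x; rewrite /N /=.
  by case: (P a x); case: (all _ l); rewrite /= ?mulr1n ?mulr0n; ring.
by rewrite !espD esp_cst //; lra.
Qed.

Lemma DHJ_at_le (K : finType) (d d' : R) : d <= d' -> DHJ_at K d -> DHJ_at K d'.
Proof.
by move=> le_d [I HI]; exists I => A /(le_trans le_d); apply: HI.
Qed.

(** Going up from [x] in steps of [e], the last failing density is critical up to [e]; no infimum
    has to be taken. *)
Lemma DHJ_at_threshold (K : finType) (x y e : R) : ~ DHJ_at K x -> DHJ_at K y -> 0 < e ->
  exists x', [/\ x <= x', ~ DHJ_at K x' & DHJ_at K (x' + e)].
Proof.
move=> nx Dy e0.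
have xy : x < y by rewrite ltNge; apply/negP => /DHJ_at_le/(_ Dy).
pose n := Num.bound ((y - x) / e).
have : DHJ_at K (x + e * n%:R).
  apply: DHJ_at_le Dy; have : (y - x) / e < n%:R.
    by apply: archi_boundP; rewrite divr_ge0 ?ltW // subr_gt0.
  by rewrite ltr_pdivrMr // mulrC; lra.
elim: n => [|n IHn]; first by rewrite mulr0 addr0.
case: (classic (DHJ_at K (x + e * n%:R))) => [/IHn //|nn Dn].
exists (x + e * n%:R); split=> //; last by move: Dn; rewrite -natr1 mulrDr mulr1 addrA.
by rewrite lerDl mulr_ge0 ?ler0n // ltW.
Qed.

(** The slacks [m + e - g t] are nonnegative with sum at most [e * #|T|], so each of them is at most
    that. *)
Lemma avg_lower_bound (T : finType) (g : T -> R) (m e : R) :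
  0 <= e -> (forall t, g t <= m + e) -> m <= avg g -> forall t, m - e * #|T|%:R <= g t.
Proof.
move=> e0 gle mle t.
have T0 : 0 < #|T|%:R :> R by rewrite ltr0n; apply/card_gt0P; exists t.
have : \sum_u (m + e - g u) <= e * #|T|%:R.
  rewrite big_split /= sumr_const sumrN -[(m + e) *+ _]mulr_natr mulrDl addrAC gerDr subr_le0.
  by move: mle; rewrite /esp -mulr_sumr mulrC ler_pdivlMr.
rewrite (bigD1 t) //=.
have : 0 <= \sum_(u | u != t) (m + e - g u) by apply: sumr_ge0 => u _; rewrite subr_ge0.
by lra.
Qed.

Lemma DHJ_option (K : finType) (a0 : K) : DHJ R K -> DHJ R (option K).
Proof.
move=> dhj d d_gt0; apply: NNPP => ndhj.
have uW (I0 : finType) := prob_unif R (card_word_gt0 I0 (None : option K)).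
have d2 : 0 < d / 2 by lra.
have [I0 [th0 [th0_gt0 H0]]] := events_DHJ a0 dhj d2.
pose th := Num.min th0 1.
have th_gt0 : 0 < th by rewrite lt_min th0_gt0 ltr01.
have th_le1 : th <= 1 by rewrite ge_min lexx orbT.
have dth_gt0 : 0 < d * th by apply: mulr_gt0.
have dth_le : d * th <= d by rewrite ler_piMr // ltW.
(* With this [g] the final lower bound [d0 - g - (d0 + g) * (1 - th)] is at least [d * th / 2],
   above the upper bound [d * th / 8]. *)
pose g := d * th / 4.
have g_gt0 : 0 < g by rewrite /g; lra.
have D2 : DHJ_at (option K) (2 : R).
  exists void => A A2; have : avg (fun x => (A x)%:R) <= 1.
    by apply: esp_le1 => // x; apply: (@ler_bool _ _ true).
  by move=> A1; exfalso; move: A1 A2; lra.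
have [d0 [d_le nd0 [I1 HI1]]] := DHJ_at_threshold ndhj D2 g_gt0.
have b_gt0 : 0 < d * th / 8 by lra.
have [I2 HI2] := insensitive_product_correlation (enum K) dhj I1 b_gt0.
have [M HM] := tail_insensitive_subspace K I0 I2 bool.
have X_gt0 : 0 < #|word M (option K)|%:R :> R by rewrite ltr0n (card_word_gt0 _ None).
(* A section may fall below the mean by [e] times the number of words over [M]; hence a second
   threshold, taken after [M], at a scale making this loss [g]. *)
pose e := g / #|word M (option K)|%:R.
have e_gt0 : 0 < e by apply: divr_gt0.
have [d1 [d0_le nd1 [Y HY]]] := DHJ_at_threshold nd0 (ex_intro _ I1 HI1) e_gt0.
have [A [A_ge noline]] : exists A : pred (word (M + Y)%type (option K)),
    d1 <= avg (fun x => (A x)%:R) /\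
    ~ exists2 l : line _ (option K), full l & forall a, A (lpoint l a).
  apply: NNPP => nA; apply: nd1; exists (M + Y)%type => A A_ge.
  by apply: NNPP => nl; apply: nA; exists A.
have lt_sub (J : finType) (c : R) : (forall B : pred (word J (option K)),
      c <= avg (fun x => (B x)%:R) -> exists2 l : line J (option K), full l &
        forall a, B (lpoint l a)) ->
    forall s : subspace (M + Y)%type J (option K), full s ->
    avg (fun z => (A (point s z))%:R) < c.
  move=> H s fs; rewrite ltNge; apply/negP => /(H (fun z => A (point s z)))[l fl Al].
  apply: noline; exists (scomp s l); first exact: full_comp.
  by move=> a; rewrite point_comp.
pose dA x : R := avg (fun y => (A (wcat x y))%:R).
have dA_ge x : d1 - g <= dA x.
  have -> : g = e * #|word M (option K)|%:R by rewrite divfK ?gt_eqF.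
  apply: avg_lower_bound (ltW e_gt0) _ _ x => [x'|]; last first.
    by move: A_ge; rewrite esp_wcat.
  have fid : full ([ffun j => inr j] : subspace Y Y (option K)).
    by move=> j; exists j; rewrite ffunE.
  apply/ltW; have := lt_sub _ _ HY _ (full_padl x' fid).
  congr (is_true (_ < _)); apply: eq_esp => y; congr (nat_of_bool (A _))%:R.
  by rewrite point_padl; congr wcat; apply/ffunP=> j; rewrite !ffunE.
pose D x y := [forall a, A (wcat (fold_None a x) y)].
(* Once [None] occurs in the [I0] part, whether [D] is dense above the point no longer depends on
   the [I2] part. *)
have [s fs Hs] := HM (fun x => th <= avg (fun y => (D x y)%:R)).
pose some_word (J : finType) (w : word J K) : word J (option K) := [ffun j => Some (w j)].
pose v0 : word I2 (option K) := [ffun=> Some a0].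
have [|l fl Hl] := H0 _ (@unif R (word Y (option K)))
    (fun w y => A (wcat (point (expand s) (wcat (some_word _ w) v0)) y)) (uW _).
  rewrite -[d / 2](esp_cst _ (prob_unif R (card_word_gt0 I0 a0))).
  apply: esp_le => [|w]; first exact: prob_unif (card_word_gt0 _ a0).
  apply: le_trans (dA_ge _); move: dth_le d_le d0_le; rewrite /g; lra.
(* [u] writes [l] as a word with [None] for the variable. As [v0] avoids [None], folding only moves
   along [l], so [D] is dense above the tail [v0] and hence above every tail. *)
pose u : word I0 (option K) := [ffun i => if l i is inl a then Some a else None].
have [p up] : exists p, u p = None by have [p lp] := fl tt; exists p; rewrite ffunE lp.
pose sv : subspace M I2 (option K) := [ffun i => match s i with
  | inl a => inl (Some a) | inr (inl p) => inl (u p) | inr (inr q) => inr q end].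
have svE v : point sv v = point (expand s) (wcat u v).
  by apply/ffunP=> i; rewrite !ffunE; case: (s i) => [a|[q|q]]; rewrite ?ffunE.
have fsv : full sv.
  by move=> q; have [i si] := fs (inr q); exists i; rewrite ffunE si.
have D_ge v : th <= avg (fun y => (D (point sv v) y)%:R).
  rewrite svE (Hs u v v0); last by exists p.
  apply: le_trans (le_trans _ Hl) _; first by rewrite ge_min lexx.
  apply: (esp_le (uW Y)) => y; apply: ler_bool => /forallP Ha; apply/forallP=> a.
  have := Ha a; congr (is_true (A (wcat _ y))); apply/ffunP=> i; rewrite !ffunE.
  case: (s i) => [b|[q|q]] //=; rewrite !ffunE //.
  by case: (l q) => // -[]; rewrite ?ffunE.
(* [D] supplies the points at the letters of [K] and [A] the point at [None] of a line over
   [option K]. *)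
have disj (x : word M (option K)) y : (exists i, x i = None) -> A (wcat x y) -> D x y -> False.
  move=> [i0 xi0] Ax /forallP Dx; apply: noline.
  exists [ffun i => match i with
    | inl i => if x i is Some a then inl (Some a) else inr tt
    | inr i => inl (y i) end].
    by case; exists (inl i0); rewrite ffunE xi0.
  case=> [a|]; [have := Dx a | have := Ax]; congr (is_true (A _));
    by apply/ffunP=> -[i|i]; rewrite !ffunE //; case: (x i) => //=; rewrite ffunE.
have sv_None v : exists i, point sv v i = None.
  by have [i si] := fs (inl p); exists i; rewrite !ffunE si -up ffunE.
pose N v y : R := (~~ D (point sv v) y)%:R.
pose f y v : R := (A (wcat (point sv v) y))%:R - (d0 + g).
have f_le y : avg (fun v => N v y * f y v) <= d * th / 8.
  (* For fixed [y], [D] along [sv] is an intersection over [a] of sets insensitive for [a]. *)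
  have [|||_] := HI2 (f y) _ _ (fun a v => A (wcat (fold_None a (point sv v)) y)).
  - move=> v; have := @ler_bool R (A (wcat (point sv v) y)) true (fun=> isT).
    by rewrite /f; move: d_gt0 d_le g_gt0; rewrite mulr1n; lra.
  - move=> s' fs'; rewrite /f espB esp_cst // subr_le0; apply: ltW.
    have := lt_sub _ _ HI1 _ (full_padr y (full_comp fsv fs')).
    by under eq_esp => z do rewrite point_padr point_comp.
  - by move=> a v; rewrite fold_point.
  apply: le_trans; rewrite le_eqVlt; apply/orP; left; apply/eqP; apply: eq_esp => v.
  rewrite /N; congr ((nat_of_bool (~~ _))%:R * _).
  by apply/forallP/allP => [Dv a _|Dv a]; rewrite Dv // mem_enum.
have avg_f : avg (fun v => avg (fun y => N v y * f y v)) <= d * th / 8.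
  by rewrite esp_exchange -[leRHS](esp_cst _ (uW Y)); apply: esp_le.
have f_ge v : d0 - g - (d0 + g) * (1 - th) <= avg (fun y => N v y * f y v).
  (* Since [A] avoids [D], multiplying by [N] keeps all of [A] and only shrinks the subtracted
     threshold. *)
  have -> : avg (fun y => N v y * f y v)
      = dA (point sv v) - (d0 + g) * (1 - avg (fun y => (D (point sv v) y)%:R)).
    rewrite -[X in X - avg _](esp_cst 1 (uW Y)) -espB -espZ -espB.
    apply: eq_esp => y; rewrite /N /f.
    case: (boolP (A _)) (disj _ y (sv_None v)) => Av; case: (D _ y) => // dis;
      rewrite /= ?mulr1n ?mulr0n.
    + by case: (dis isT isT).
    + by ring.
    + by ring.
    + by ring.
  have := dA_ge (point sv v); have := D_ge v.
  set x := avg _; set z := dA _ => thx dz.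
  have dg : 0 < d0 + g by move: d_gt0 d_le g_gt0; lra.
  by nra.
have := le_trans (esp_le (uW I2) f_ge) avg_f.
by rewrite esp_cst // /g; move: d_gt0 d_le th_gt0 dth_gt0; nra.
Qed.

(** Iterating [option] matches the induction step, which needs a letter [a0] and so starts from one
    letter. *)
Fixpoint alphabet (k : nat) : finType := if k is k'.+1 then option (alphabet k') else unit.

Lemma card_alphabet k : #|alphabet k| = k.+1.
Proof. by elim: k => [|k IHk]; rewrite ?card_unit //= card_option IHk. Qed.

Theorem density_hales_jewett k : DHJ R (alphabet k).
Proof.
elim: k => [|k IHk]; last first.
  apply: DHJ_option IHk.
  exact: (enum_val (cast_ord (esym (card_alphabet k)) ord0)).
move=> d d_gt0; exists unit => A dA; exists [ffun=> inr tt].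
  by case; exists tt; rewrite ffunE.
case; apply: contraLR isT => nA; move: dA.
rewrite (eq_esp _ (g := fun=> 0)) ?esp_cst ?leNgt ?d_gt0 //.
  exact: prob_unif (card_word_gt0 _ tt).
move=> x; move: nA; have -> : lpoint [ffun=> inr tt] tt = x; last by move/negPf->.
by apply/ffunP=> -[]; rewrite !ffunE; case: (x tt).
Qed.

End DensityIncrement.

(** * Words over [1..k] *)

Section Encoding.
Variables (I K : finType) (i0 : I) (a0 : K).

Definition letter (a : K) : nat := (index a (enum K)).+1.
Definition unletter (n : nat) : K := nth a0 (enum K) n.-1.

Lemma letterK n : (1 <= n /\ n <= #|K|)%coq_nat -> letter (unletter n) = n.
Proof.
case=> /ssrnat.leP n0 /ssrnat.leP nK; rewrite /letter /unletter index_uniq ?prednK ?enum_uniq //.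
by rewrite -cardE; case: n n0 nK.
Qed.

Definition code (x : word I K) : list nat := [seq letter (x i) | i <- enum I].

Lemma Forall_letters (f : I -> K) :
  List.Forall (fun n => (1 <= n /\ n <= #|K|)%coq_nat) [seq letter (f i) | i <- enum I].
Proof.
elim: (enum I) => [|i s IHs] /=; constructor=> //; split; apply/ssrnat.leP => //.
by rewrite /letter cardE index_mem mem_enum.
Qed.

Lemma code_is_word x : is_word #|K| (code x).
Proof.
split; last exact: Forall_letters.
have : i0 \in enum I by rewrite mem_enum.
by rewrite /code; case: (enum I).
Qed.

Definition code_word x : Word #|K| := exist _ (code x) (code_is_word x).

Definition line_set (l : line I K) (m : nat) : bool :=
  if l (nth i0 (enum I) m) is inr _ then true else false.

Definition line_base (l : line I K) : list nat :=
  [seq letter (if l i is inl a then a else a0) | i <- enum I].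

Lemma List_seqE m n : List.seq m n = iota m n.
Proof. by elim: n m => //= n IHn m; rewrite IHn. Qed.

Lemma List_nthE (s : seq nat) n : List.nth n s 0%N = nth 0%N s n.
Proof. by elim: s n => [|x s IHs] [|n] //=. Qed.

Lemma line_data (l : line I K) : full l ->
  is_line_data #|K| #|I| (line_set l) (line_base l).
Proof.
move=> fl; split; first by apply/ssrnat.leP/card_gt0P; exists i0.
split; last first.
  split; last exact: Forall_letters.
  by rewrite -[LHS]/(size (line_base l)) size_map cardE.
have [i li] := fl tt; exists (index i (enum I)).
split; first by apply/ssrnat.leP; rewrite cardE index_mem mem_enum.
by rewrite /line_set nth_index ?mem_enum // li.
Qed.

Lemma code_lpoint (l : line I K) n : (1 <= n /\ n <= #|K|)%coq_nat ->
  code (lpoint l (unletter n)) = line_word #|I| (line_set l) (line_base l) n.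
Proof.
move=> nK; rewrite /line_word List_seqE.
rewrite -[RHS]/(map (fun m => if line_set l m then n else List.nth m (line_base l) 0%N) _).
rewrite /code -{1}[enum I](mkseq_nth i0) /mkseq -map_comp -cardE.
apply/eq_in_map => m; rewrite mem_iota /= => mI.
rewrite /comp ffunE List_nthE /line_base [nth 0%N _ m](nth_map i0) -?cardE // /line_set.
by case: (l _) => //= -[]; rewrite ffunE letterK.
Qed.

End Encoding.

(** With [ws] all words of one length and [Ls] all their lines, the measure argument needs only
    finite sums and finite unions of null sets. *)
Lemma finite_density_hales_jewett (k : nat) (d : R) :
  (1 <= k)%coq_nat -> Rlt (IZR 0) d ->
  exists (ws : list (Word k)) (Ls : list (nat -> Word k)), ws <> nil /\
    (forall phi, List.In phi Ls -> exists (N1 : nat) (I1 : nat -> bool) (w : list nat),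
       is_line_data k N1 I1 w /\
       forall i, (1 <= i /\ i <= k)%coq_nat -> proj1_sig (phi i) = line_word N1 I1 w i) /\
    (forall x : Config k,
       Rle (Rmult d (INR (List.length ws))) (INR (List.length (List.filter x ws))) ->
       exists phi, List.In phi Ls /\ forall i, (1 <= i /\ i <= k)%coq_nat -> x (phi i) = true).
Proof.
case: k => [|k] k1 /RltP d_gt0; first by case/ssrnat.leP: k1.
rewrite -(card_alphabet k); set K := alphabet k.
have a0 : K by apply: (enum_val (cast_ord (esym (card_alphabet k)) ord0)).
(* The cap at 1 lets the set of all words qualify; a line in it has a variable coordinate, so [I] is
   nonempty. *)
have e_gt0 : 0 < Num.min d 1 by rewrite lt_min d_gt0 ltr01.
have [I HI] := density_hales_jewett k e_gt0.
have uW : prob (@unif R (word I K)) by apply: prob_unif (card_word_gt0 _ a0).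
have [i0 _] : exists i : I, true.
  have [|l fl _] := HI predT; first by rewrite (esp_cst 1 uW) ge_min lexx orbT.
  by have [i _] := fl tt; exists i.
exists (List.map (code_word i0) (enum (word I K))).
exists (List.map (fun l n => code_word i0 (lpoint l (unletter a0 n)))
   [seq l : line I K <- enum (line I K) | [forall j, exists i, l i == inr j]]).
have InE (T : eqType) (t : T) s : t \in s -> List.In t s.
  by elim: s => //= u s IHs; rewrite inE => /orP[/eqP->|/IHs]; [left|right].
have EIn (T : eqType) (t : T) s : List.In t s -> t \in s.
  by elim: s => //= u s IHs [->|/IHs]; rewrite inE ?eqxx // => ->; rewrite orbT.
split=> [ws0|].
  have := InE _ [ffun=> a0] (enum (word I K)); rewrite mem_enum => /(_ isT).
  by move: ws0; case: (enum _).
split=> [phi|x].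
  case/List.in_map_iff=> l [<- /EIn]; rewrite mem_filter => /andP[/fullP fl _].
  exists #|I|, (line_set i0 l), (line_base a0 l); split; first exact: line_data.
  by move=> n nK; apply: code_lpoint.
rewrite !List.length_map => /RleP.
have -> : List.length (List.filter x (List.map (code_word i0) (enum (word I K))))
    = #|[pred w | x (code_word i0 w)]|.
  rewrite [RHS]cardE /enum_mem size_filter.
  by elim: (Finite.enum _) => //= w s <-; rewrite inE; case: (x _).
have -> : List.length (Finite.enum (word I K : finType)) = #|word I K|.
  by rewrite cardE enumT.
rewrite !INRE => dle.
have [|l fl Hl] := HI (fun w => x (code_word i0 w)).
  rewrite ge_min; apply/orP; left; rewrite /esp -mulr_sumr /unif mulrC.
  rewrite ler_pdivlMr ?ltr0n ?(card_word_gt0 _ a0) //; apply: le_trans dle _.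
  by rewrite -natr_sum ler_nat -sum1_card [leqLHS]big_mkcond leq_sum.
exists (fun n => code_word i0 (lpoint l (unletter a0 n))); split=> [|n _]; last exact: Hl.
by apply/List.in_map/InE; rewrite mem_filter mem_enum andbT; apply/fullP.
Qed.

End DensityHalesJewett.

Open Scope R_scope.

(** * Borel probability measures on configurations *)

Lemma cset_ext (k : nat) (A B : cset k) : (forall x, A x <-> B x) -> A = B.
Proof.
  intros AB; apply functional_extensionality; intros x.
  apply propositional_extensionality, AB.
Qed.

Lemma borel_compl (k : nat) (A : cset k) : borel k A -> borel k (fun x => ~ A x).
Proof. intros bA S sS oS; apply (proj1 (proj2 sS)), bA; assumption. Qed.

Lemma borel_union (k : nat) (A : nat -> cset k) :
  (forall n, borel k (A n)) -> borel k (fun x => exists n, A n x).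
Proof.
  intros bA S sS oS; apply (proj2 (proj2 sS)); intros n; apply bA; assumption.
Qed.

Lemma borel_open (k : nat) (U : cset k) : is_open k U -> borel k U.
Proof. intros oU S sS oS; apply oS, oU. Qed.

Lemma borel_True (k : nat) : borel k (fun _ => True).
Proof. intros S sS _; apply sS. Qed.

Lemma borel_False (k : nat) : borel k (fun _ => False).
Proof.
  replace (fun _ : Config k => False) with (fun _ : Config k => ~ True).
  - apply borel_compl, borel_True.
  - apply cset_ext; tauto.
Qed.

Lemma borel_or (k : nat) (A B : cset k) :
  borel k A -> borel k B -> borel k (fun x => A x \/ B x).
Proof.
  intros bA bB.
  replace (fun x => A x \/ B x) with
    (fun x => exists n : nat, (match n with 0%nat => A | _ => B end) x).
  - apply borel_union; intros [|n]; assumption.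
  - apply cset_ext; intros x; split.
    + intros [[|n] H]; tauto.
    + intros [H|H]; [exists 0%nat | exists 1%nat]; assumption.
Qed.

Lemma borel_and (k : nat) (A B : cset k) :
  borel k A -> borel k B -> borel k (fun x => A x /\ B x).
Proof.
  intros bA bB.
  replace (fun x => A x /\ B x) with (fun x => ~ (~ A x \/ ~ B x)).
  - apply borel_compl, borel_or; apply borel_compl; assumption.
  - apply cset_ext; intros x; tauto.
Qed.

Lemma borel_cylinder (k : nat) (w : Word k) : borel k (fun x => x w = true).
Proof.
  apply borel_open; intros x xw; exists (w :: nil); intros y yx.
  rewrite yx; [assumption | left; reflexivity].
Qed.

Section Measure.
Variables (k : nat) (mu : cset k -> R).
Hypothesis mu_prob : borel_prob_measure k mu.

Lemma measure_False : mu (fun _ => False) = 0.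
Proof.
  destruct mu_prob as [_ [_ add]].
  specialize (add (fun _ _ => False) (fun _ => borel_False k)).
  assert (H := add (fun n m x _ f _ => f)); clear add; cbv beta in H.
  replace (fun _ : Config k => exists _ : nat, False) with (fun _ : Config k => False) in H
    by (apply cset_ext; intros x; split; [tauto | intros [_ []]]).
  set (c := mu (fun _ => False)) in *.
  (* a series with constant term [c] only converges if [c = 0] *)
  apply NNPP; intros c0.
  destruct (H (Rabs c / 2)) as [N HN].
  { pose proof (Rabs_pos_lt c c0); lra. }
  pose proof (HN N (le_n N)) as H1; pose proof (HN (S N) (Nat.le_succ_diag_r N)) as H2.
  unfold Rdist in *; simpl in H2.
  set (s := sum_f_R0 (fun _ => c) N) in *.
  pose proof (Rabs_triang (s + c - c) (- (s - c))) as T.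
  replace (s + c - c + - (s - c)) with c in T by ring.
  rewrite Rabs_Ropp in T; lra.
Qed.

(** Countable additivity for two pieces followed by empty sets, which have measure 0. *)
Lemma measure_split (A B : cset k) : borel k A -> borel k B ->
  mu A = mu (fun x => A x /\ B x) + mu (fun x => A x /\ ~ B x).
Proof.
  intros bA bB; destruct mu_prob as [_ [_ add]].
  set (F := fun n : nat => match n with
     | 0%nat => fun x => A x /\ B x
     | 1%nat => fun x => A x /\ ~ B x
     | _ => fun _ => False end : cset k).
  assert (H : infinite_sum (fun n => mu (F n)) (mu (fun x => exists n, F n x))).
  { apply add.
    - intros [|[|n]]; simpl.
      + apply borel_and; assumption.
      + apply borel_and; [|apply borel_compl]; assumption.
      + apply borel_False.
    - intros [|[|n]] [|[|m]] x nm; simpl; tauto. }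
  replace (fun x => exists n, F n x) with A in H.
  2:{ apply cset_ext; intros x; split.
      - intros Ax; destruct (classic (B x)); [exists 0%nat | exists 1%nat]; simpl; tauto.
      - intros [[|[|n]] Fx]; simpl in Fx; tauto. }
  apply (uniqueness_sum _ _ _ H).
  intros eps e0; exists 1%nat; intros n n1.
  replace (sum_f_R0 (fun n => mu (F n)) n) with (mu (F 0%nat) + mu (F 1%nat)).
  - unfold Rdist; simpl; rewrite Rminus_diag, Rabs_R0; assumption.
  - induction n1 as [|n n1 IH]; [reflexivity|].
    rewrite tech5, <- IH; destruct n as [|n]; [lia|].
    simpl; rewrite measure_False; ring.
Qed.

Lemma measure_ge0 (A : cset k) : borel k A -> 0 <= mu A.
Proof. apply mu_prob. Qed.

Lemma measure_le (A B : cset k) : borel k A -> borel k B ->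
  (forall x, A x -> B x) -> mu A <= mu B.
Proof.
  intros bA bB AB; rewrite (measure_split B A) by assumption.
  replace (fun x => B x /\ A x) with A.
  - assert (H : 0 <= mu (fun x => B x /\ ~ A x)).
    { apply measure_ge0, borel_and; [|apply borel_compl]; assumption. }
    lra.
  - apply cset_ext; intros x; split; [intros Ax; split; auto | tauto].
Qed.

Lemma measure_or_null (A B : cset k) : borel k A -> borel k B ->
  mu A = 0 -> mu B = 0 -> mu (fun x => A x \/ B x) = 0.
Proof.
  intros bA bB A0 B0; assert (bAB := borel_or k A B bA bB).
  rewrite (measure_split _ A) by assumption.
  assert (H1 : mu (fun x => (A x \/ B x) /\ A x) <= mu A).
  { apply measure_le; try tauto; apply borel_and; assumption. }
  assert (H2 : mu (fun x => (A x \/ B x) /\ ~ A x) <= mu B).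
  { apply measure_le; try tauto; apply borel_and; [|apply borel_compl]; assumption. }
  assert (H3 : 0 <= mu (fun x => (A x \/ B x) /\ A x)).
  { apply measure_ge0, borel_and; assumption. }
  assert (H4 : 0 <= mu (fun x => (A x \/ B x) /\ ~ A x)).
  { apply measure_ge0, borel_and; [|apply borel_compl]; assumption. }
  lra.
Qed.

(** This is the integral over [G] of the number of [w] in [ws] with [x w = true]. *)
Definition total_mass (G : cset k) (ws : list (Word k)) : R :=
  fold_right (fun w s => mu (fun x => G x /\ x w = true) + s) 0 ws.

Lemma total_mass_split (G B : cset k) (ws : list (Word k)) : borel k G -> borel k B ->
  total_mass G ws = total_mass (fun x => G x /\ B x) ws + total_mass (fun x => G x /\ ~ B x) ws.
Proof.
  intros bG bB; induction ws as [|w ws IH]; simpl; [ring|].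
  rewrite IH, (measure_split (fun x => G x /\ x w = true) B);
    [| apply borel_and; [|apply borel_cylinder]; assumption | assumption].
  replace (fun x => (G x /\ x w = true) /\ B x) with (fun x => (G x /\ B x) /\ x w = true)
    by (apply cset_ext; tauto).
  replace (fun x => (G x /\ x w = true) /\ ~ B x) with (fun x => (G x /\ ~ B x) /\ x w = true)
    by (apply cset_ext; tauto).
  ring.
Qed.

(* The integral of a pointwise bound, by splitting [G] along one coordinate at a time. *)
Lemma total_mass_le (Z : cset k) : borel k Z -> mu Z = 0 ->
  forall (ws : list (Word k)) (G : cset k) (c : R), borel k G ->
  (forall x, G x -> ~ Z x -> INR (length (filter x ws)) <= c) ->
  total_mass G ws <= c * mu G.
Proof.
  intros bZ Z0; induction ws as [|w ws IH]; intros G c bG Hc; simpl.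
  (* That [c] is nonnegative is only known from a point of [G] outside [Z]; without one, [G] is
     null. *)
  - destruct (classic (exists x, G x /\ ~ Z x)) as [[x [Gx Zx]]|none].
    + apply Rmult_le_pos; [exact (Hc x Gx Zx) | apply measure_ge0; assumption].
    + replace (mu G) with 0; [lra|].
      apply Rle_antisym; [apply measure_ge0; assumption|].
      rewrite <- Z0; apply measure_le; try assumption.
      intros x Gx; apply NNPP; intros Zx; apply none; exists x; tauto.
  - set (B := fun x : Config k => x w = true).
    assert (bB : borel k B) by apply borel_cylinder.
    rewrite (total_mass_split G B ws), (measure_split G B) by assumption.
    (* On [B] the word [w] uses up one of the at most [c] true values. *)
    assert (H1 : total_mass (fun x => G x /\ B x) ws <= (c - 1) * mu (fun x => G x /\ B x)).
    { apply IH; [apply borel_and; assumption|].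
      intros x [Gx Bx] Zx; specialize (Hc x Gx Zx); simpl in Hc.
      unfold B in Bx; rewrite Bx in Hc; simpl length in Hc; rewrite S_INR in Hc; lra. }
    assert (H2 : total_mass (fun x => G x /\ ~ B x) ws <= c * mu (fun x => G x /\ ~ B x)).
    { apply IH; [apply borel_and; [|apply borel_compl]; assumption|].
      intros x [Gx Bx] Zx; specialize (Hc x Gx Zx); simpl in Hc.
      unfold B in Bx; destruct (x w); [tauto | assumption]. }
    change (mu (fun x => G x /\ x w = true)) with (mu (fun x => G x /\ B x)); lra.
Qed.

End Measure.

(** * Null lines and the conclusion *)

Lemma borel_line (k : nat) (phi : nat -> Word k) :
  borel k (fun x => forall i, (1 <= i <= k)%nat -> x (phi i) = true).
Proof.
  apply borel_open; intros x Hx; exists (map phi (seq 1 k)).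
  intros y yx i ik; rewrite yx; [apply Hx; assumption|].
  apply in_map, in_seq; lia.
Qed.

Lemma null_lines (k : nat) (mu : cset k -> R) (Ls : list (nat -> Word k)) :
  borel_prob_measure k mu ->
  (forall phi, In phi Ls -> mu (fun x => forall i, (1 <= i <= k)%nat -> x (phi i) = true) = 0) ->
  exists Z : cset k, borel k Z /\ mu Z = 0 /\
    forall x phi, In phi Ls -> (forall i, (1 <= i <= k)%nat -> x (phi i) = true) -> Z x.
Proof.
  intros pmu; induction Ls as [|phi Ls IH]; intros H0.
  - exists (fun _ => False); split; [apply borel_False|].
    split; [apply measure_False; assumption | simpl; tauto].
  - destruct IH as [Z [bZ [Z0 HZ]]]; [intros; apply H0; right; assumption|].
    exists (fun x => (forall i, (1 <= i <= k)%nat -> x (phi i) = true) \/ Z x).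
    split; [apply borel_or; [apply borel_line | assumption]|]; split.
    + apply measure_or_null; try assumption; [apply borel_line | apply H0; left; reflexivity].
    + intros x psi [->|Hpsi] Hx; [left; assumption | right; eapply HZ; eassumption].
Qed.

Theorem theorem5p1 (k : nat) (delta : R) (mu : cset k -> R) :
  (1 <= k)%nat -> 0 < delta ->
  borel_prob_measure k mu ->
  (forall w : Word k, mu (fun x => x w = true) >= delta) ->
  exists (N1 : nat) (I1 : nat -> bool) (w : list nat) (phi : nat -> Word k),
    is_line_data k N1 I1 w /\
    (forall i, (1 <= i <= k)%nat -> proj1_sig (phi i) = line_word N1 I1 w i) /\
    mu (fun x => forall i, (1 <= i <= k)%nat -> x (phi i) = true) > 0.
Proof.
  intros k1 delta0 pmu Hmu.
  (* Any density strictly between 0 and the mean density [delta] would do. *)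
  destruct (@DensityHalesJewett.finite_density_hales_jewett k (delta / 2) k1)
    as [ws [Ls [ws0 [Hlines Hdense]]]];
    [lra|].
  apply NNPP; intros none.
  destruct (null_lines k mu Ls pmu) as [Z [bZ [Z0 HZ]]].
  { intros phi Hphi; apply Rle_antisym; [|apply measure_ge0, borel_line; assumption].
    apply Rnot_lt_le; intros pos; apply none.
    destruct (Hlines phi Hphi) as [N1 [I1 [w [Hd Hw]]]].
    exists N1, I1, w, phi; split; [|split]; assumption. }
  assert (up : total_mass k mu (fun _ => True) ws
               <= delta / 2 * INR (length ws) * mu (fun _ => True)).
  { apply (total_mass_le k mu pmu Z bZ Z0); [apply borel_True|].
    (* Outside [Z] no line of [Ls] is all true, so the proportion of true words is below
       [delta / 2]. *)
    intros x _ Zx; apply Rlt_le, Rnot_le_lt; intros dense; apply Zx.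
    destruct (Hdense x dense) as [phi [Hphi Hx]]; exact (HZ x phi Hphi Hx). }
  assert (low : delta * INR (length ws) <= total_mass k mu (fun _ => True) ws).
  { clear - Hmu; induction ws as [|w ws IH]; [simpl; lra|].
    simpl length; rewrite S_INR; simpl.
    replace (fun x : Config k => True /\ x w = true) with (fun x : Config k => x w = true)
      by (apply cset_ext; tauto).
    specialize (Hmu w); lra. }
  replace (mu (fun _ => True)) with 1 in up by (symmetry; apply pmu).
  assert (len : 0 < INR (length ws)).
  { apply lt_0_INR; destruct ws; [contradiction | simpl; lia]. }
  nra.
Qed.
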